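(* Consider the water wave problem: velocity field $(u,v)(t,x,y)$, pressure $P(t,x,y)$ and free surface $y=\eta(t,x)$ satisfy $$u_t+uu_x+vu_y=-P_x,\qquad v_t+uv_x+vv_y=-P_y-g,\qquad u_x+v_y=0$$ in the fluid domain $-d<y<\eta(t,x)$, together with $$v=\eta_t+\eta_x u,\qquad P=P_0\qquad\text{on } y=\eta(t,x),$$ and $v=0$ on $y=-d$. Assume a setting in which classical solutions of this problem are unique for given initial data. Then any horizontally symmetric ($x$-symmetric) classical solution $(u,v,P,\eta)$ is a steady wave: there is a constant $c\in\mathbb{R}$ such that $u$, $v$, $P$ depend on $(t,x,y)$ only through $(x-ct,y)$ and $\eta$ depends on $(t,x)$ only through $x-ct$.
   Context: Here $t>0$, $x\in\mathbb{R}$, $\mathbb{R}_+=(0,\infty)$, and $g$ (gravitational acceleration), $d>0$ (position of the flat bed) and $P_0$ (constant atmospheric pressure) are constants. A classical solution $(u,v,P,\eta)$ is one for which $u,v,P$ are continuously differentiable in $t$ and twice continuously differentiable in the space variables $(x,y)$ up to the boundary of the fluid domain, $\eta\in C^1(\mathbb{R}_+\times\mathbb{R})$, and all equations hold pointwise. Uniqueness for given initial data means: two classical solutions $(u,v,P,\eta)$ which coincide at some time $t_0$ coincide at all later times. A solution $(u,v,P,\eta)$ is $x$-symmetric (horizontally symmetric) if there exists a function $\lambda\in C^1(\mathbb{R}_+)$ such that for every $t>0$ and almost every $x\in\mathbb{R}$, $$u(t,x,y)=u(t,2\lambda(t)-x,y),\quad v(t,x,y)=-v(t,2\lambda(t)-x,y),$$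 $$P(t,x,y)=P(t,2\lambda(t)-x,y),\quad \eta(t,x)=\eta(t,2\lambda(t)-x).$$ *)

(* Defs.v *)
From HB Require Import structures.
From mathcomp Require Import all_boot all_order all_algebra.
From mathcomp Require Import all_classical all_reals all_analysis.

Set Implicit Arguments.
Unset Strict Implicit.
Unset Printing Implicit Defensive.

Import Order.TTheory GRing.Theory Num.Theory.
Import numFieldNormedType.Exports.

Local Open Scope classical_set_scope.
Local Open Scope ring_scope.

(* The unknowns (u, v, P, eta).  The functions are total; velx, vely and press
   are only ever constrained or compared on the closed fluid domain at positive
   times, and surf only at positive times. *)
Record wave (R : realType) := Wave {
  velx : R -> R -> R -> R;
  vely : R -> R -> R -> R;
  press : R -> R -> R -> R;
  surf : R -> R -> R
}.

Section FluidDomain.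
Variables (R : realType) (d : R) (eta : R -> R -> R).

(* Points are ((t, x), y). *)
Definition fluid : set (R * R * R) :=
  [set p | [/\ 0 < p.1.1, - d < p.2 & p.2 < eta p.1.1 p.1.2]].

(* Closed in the space variables only: time stays in (0, +oo). *)
Definition fluid_closed : set (R * R * R) :=
  [set p | [/\ 0 < p.1.1, - d <= p.2 & p.2 <= eta p.1.1 p.1.2]].

End FluidDomain.

Section PartialDerivatives.
Variable R : realType.
Implicit Type f : R -> R -> R -> R.

Definition dt f : R -> R -> R -> R := fun t x y => derive1 (fun s => f s x y) t.
Definition dx f : R -> R -> R -> R := fun t x y => derive1 (fun z => f t z y) x.
Definition dy f : R -> R -> R -> R := fun t x y => derive1 (fun z => f t x z) y.

Definition surf_t (eta : R -> R -> R) : R -> R -> R :=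
  fun t x => derive1 (fun s => eta s x) t.
Definition surf_x (eta : R -> R -> R) : R -> R -> R :=
  fun t x => derive1 (fun z => eta t z) x.

End PartialDerivatives.

Section Regularity.
Variables (R : realType) (d : R) (eta : R -> R -> R).
Implicit Type f : R -> R -> R -> R.

(* f, as a function on the open fluid domain, is jointly continuous in
   (t, x, y) up to the bed and the free surface. *)
Definition extends_continuously f : Prop :=
  exists2 G : R * R * R -> R,
    {within fluid_closed d eta, continuous G} &
    forall t x y : R, fluid d eta (t, x, y) -> f t x y = G (t, x, y).

Definition C1_in_t f : Prop :=
  (forall t x y : R, fluid d eta (t, x, y) -> derivable (fun s => f s x y) t 1) /\
  extends_continuously (dt f).

Definition C1_in_x f : Prop :=
  (forall t x y : R, fluid d eta (t, x, y) -> derivable (fun z => f t z y) x 1) /\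
  extends_continuously (dx f).

Definition C1_in_y f : Prop :=
  (forall t x y : R, fluid d eta (t, x, y) -> derivable (fun z => f t x z) y 1) /\
  extends_continuously (dy f).

Definition C1_in_space f : Prop := C1_in_x f /\ C1_in_y f.

Definition C2_in_space f : Prop :=
  [/\ C1_in_space f, C1_in_space (dx f) & C1_in_space (dy f)].

(* Unlike those of the derivatives, the boundary values of f are its own. *)
Definition regular_up_to_boundary f : Prop :=
  [/\ {within fluid_closed d eta, continuous (fun p => f p.1.1 p.1.2 p.2)},
      C1_in_t f & C2_in_space f].

Definition C1_surface : Prop :=
  forall t x : R, 0 < t ->
    [/\ derivable (fun s => eta s x) t 1,
        derivable (fun z => eta t z) x 1,
        {for (t, x), continuous (fun p : R * R => surf_t eta p.1 p.2)} &
        {for (t, x), continuous (fun p : R * R => surf_x eta p.1 p.2)}].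

End Regularity.

Section WaterWaves.
Variables (R : realType) (g d P0 : R).
Implicit Types (w : wave R) (lambda : R -> R).

Definition euler_equations w : Prop :=
  let u := velx w in let v := vely w in let P := press w in
  forall t x y : R, fluid d (surf w) (t, x, y) ->
    [/\ dt u t x y + u t x y * dx u t x y + v t x y * dy u t x y
          = - dx P t x y,
        dt v t x y + u t x y * dx v t x y + v t x y * dy v t x y
          = - dy P t x y - g &
        dx u t x y + dy v t x y = 0].

Definition surface_conditions w : Prop :=
  let eta := surf w in
  forall t x : R, 0 < t ->
    vely w t x (eta t x)
      = surf_t eta t x + surf_x eta t x * velx w t x (eta t x) /\
    press w t x (eta t x) = P0.

Definition bed_condition w : Prop :=
  forall t x : R, 0 < t -> vely w t x (- d) = 0.

Definition classical_solution w : Prop :=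
  let eta := surf w in
  [/\ (* no dry bed: implicit in the fluid domain - d < y < eta *)
      forall t x : R, 0 < t -> - d < eta t x,
      C1_surface eta,
      [/\ regular_up_to_boundary d eta (velx w),
          regular_up_to_boundary d eta (vely w) &
          regular_up_to_boundary d eta (press w)] &
      [/\ euler_equations w, surface_conditions w & bed_condition w]].

Definition C1_positive_times lambda : Prop :=
  forall t : R, 0 < t ->
    derivable lambda t 1 /\ {for t, continuous (derive1 lambda)}.

Definition x_symmetric w : Prop :=
  exists2 lambda : R -> R, C1_positive_times lambda &
  forall t : R, 0 < t -> \forall x \ae (@lebesgue_measure R),
    surf w t x = surf w t (2 * lambda t - x) /\
    forall y : R, fluid_closed d (surf w) (t, x, y) ->
      [/\ velx w t x y = velx w t (2 * lambda t - x) y,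
          vely w t x y = - vely w t (2 * lambda t - x) y &
          press w t x y = press w t (2 * lambda t - x) y].

Definition steady_wave w : Prop :=
  exists c : R, exists U V Q : R -> R -> R, exists N : R -> R,
  forall t x : R, 0 < t ->
    surf w t x = N (x - c * t) /\
    forall y : R, fluid_closed d (surf w) (t, x, y) ->
      [/\ velx w t x y = U (x - c * t) y,
          vely w t x y = V (x - c * t) y &
          press w t x y = Q (x - c * t) y].

Definition coincide_at (t : R) (w1 w2 : wave R) : Prop :=
  forall x, surf w1 t x = surf w2 t x /\
    forall y : R, fluid_closed d (surf w1) (t, x, y) ->
      [/\ velx w1 t x y = velx w2 t x y,
          vely w1 t x y = vely w2 t x y &
          press w1 t x y = press w2 t x y].

End WaterWaves.

(* A setting for the initial value problem prescribes a class of admissible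
   instantaneous states (u, v, P, eta)(t, .), e.g. through periodicity, decay
   or a sign condition; a solution belongs to the setting when its state is
   admissible at all times.  The class fun _ => True gives the setting of all
   classical solutions. *)
Section Settings.
Variable R : realType.

Record state := State {
  state_velx : R -> R -> R;
  state_vely : R -> R -> R;
  state_press : R -> R -> R;
  state_surf : R -> R
}.

Definition state_at (w : wave R) (t : R) : state :=
  State (velx w t) (vely w t) (press w t) (surf w t).

Definition shift_state (a : R) (s : state) : state :=
  State (fun x y => state_velx s (x - a) y) (fun x y => state_vely s (x - a) y)
        (fun x y => state_press s (x - a) y) (fun x => state_surf s (x - a)).

(* Neither the equations nor the flat bed single out a horizontal origin, and
   neither may the class of admissible states. *)
Definition translation_invariant (X : state -> Prop) : Prop :=
  forall (a : R) (s : state), X s -> X (shift_state a s).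

Definition solution_in (g d P0 : R) (X : state -> Prop) (w : wave R) : Prop :=
  classical_solution g d P0 w /\ forall t : R, 0 < t -> X (state_at w t).

Definition unique_for_initial_data (g d P0 : R) (X : state -> Prop) : Prop :=
  forall w1 w2 : wave R,
    solution_in g d P0 X w1 -> solution_in g d P0 X w2 ->
  forall t0 : R, 0 < t0 -> coincide_at d t0 w1 w2 ->
  forall t : R, t0 <= t -> coincide_at d t w1 w2.

End Settings.

(* Main.v *)
Require Import Defs.
From mathcomp Require Import all_boot all_order all_algebra.
From mathcomp Require Import all_classical all_reals all_analysis.
From mathcomp Require Import ring lra.
Import Order.TTheory GRing.Theory Num.Theory.
Import numFieldNormedType.Exports.
Local Open Scope ring_scope.

(** At each instant a symmetric wave looks, to first order in time, like a wave
    travelling at the speed of its axis of symmetry, and uniqueness turns this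
    infinitesimal statement into a global one.

    Let x' = 2 lambda(t) - x.  Differentiating the symmetry relations gives
    u_x = - u_x', v_x = v_x' and so on, primes marking values at the reflected
    point, while the time derivatives pick up the motion of the axis:
    u_t = u_t' + 2 lambda_t u_x'.  On the other hand, the momentum equations
    and the kinematic condition at (x, y) and at (x', y), compared by means of
    the symmetry, give u_t = - u_t', v_t = v_t' and eta_t = - eta_t'.
    Together: u_t = - lambda_t u_x, v_t = - lambda_t v_x and
    eta_t = - lambda_t eta_x ([symmetric_drifts]).

    Now fix t0, put c = lambda_t(t0), and launch the state of the wave at t0 as
    a rigid profile moving at speed c.  The space derivatives of the launched
    wave are those of the given one at time t0, and because of the relations
    above so are its time derivatives; the equations, none of which involves
    t or x explicitly, therefore hold for it at all times because they hold
    for the given wave at time t0 ([launch_solution]).  Both waves agree at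
    t0, so by uniqueness they agree ever after: from any t0 on, the wave is
    the translate of its state at t0 with speed lambda_t(t0).

    The speeds belonging to different t0 agree unless the profile is
    independent of x, in which case the speed is irrelevant, and so a single
    speed serves for all positive times ([steady_of_translations]).

    Classical solutions come with continuous partial derivatives only, so the
    chain rule along the moving reflected point has to be derived from them;
    this is [is_derive_along].  The symmetry is first upgraded from almost
    every x to every x by continuity. *)

(** * Partial derivatives of functions of two real variables *)

Section PartialDerivativeCalculus.
Local Open Scope classical_set_scope.
Context {R : realType}.
Implicit Types (t x a k : R) (f g gamma : R -> R) (F : R -> R -> R).

Lemma is_derive_derive1 f x : derivable f x 1 -> is_derive x 1 f (derive1 f x).
Proof. by move=> fx; apply: DeriveDef => //; rewrite derive1E. Qed.

Lemma ae_mono (P Q : R -> Prop) : (forall x, P x -> Q x) ->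
  (\forall x \ae (@lebesgue_measure R), P x) ->
  \forall x \ae (@lebesgue_measure R), Q x.
Proof.
by move=> PQ [N [mN N0 sub]]; exists N; split => // x nQx; apply: sub => /= /PQ.
Qed.

(** The set where two continuous functions differ is open, so it contains a
    ball, of positive measure, as soon as it is not empty. *)
Lemma continuous_eq_ae f g : continuous f -> continuous g ->
  (\forall x \ae (@lebesgue_measure R), f x = g x) -> forall x, f x = g x.
Proof.
move=> cf cg [N [mN N0 sub]] x; apply: contrapT => /eqP neq.
have : \forall z \near x, 0 < `|f z - g z|.
  apply: (@cvgr_gt _ _ (nbhs x) _ _ `|f x - g x|).
    apply: cvg_norm; apply: cvgB; [exact: cf | exact: cg].
  by rewrite normr_gt0 subr_eq0.
move=> /nbhs_ballP[e /= e0 be].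
have : (lebesgue_measure (ball x e) <= lebesgue_measure N)%E.
  apply: le_measure; rewrite ?inE //.
    by rewrite ball_itv; exact: measurable_itv.
  move=> z /be /= hz; apply: sub => /= fgz.
  by move: hz; rewrite fgz subrr normr0 ltxx.
rewrite N0 (lebesgue_measure_ball _ (ltW e0)) lee_fin leNgt => /negP; apply.
by rewrite pmulrn_lgt0.
Qed.

(** The mean value theorem for either order of x and z. *)
Lemma mean_value_slope f (x z r : R) : z != x -> `|z - x| < r ->
  (forall y, `|y - x| < r -> derivable f y 1) ->
  exists2 c, `|c - x| < r & (f z - f x) / (z - x) = derive1 f c.
Proof.
move=> zx zr df.
have cf y : `|y - x| < r -> {for y, continuous f}.
  by move=> /df /derivable1_diffP /differentiable_continuous.
have mvt (a b : R) : a < b ->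
    (forall y : R, a <= y -> y <= b -> `|y - x| < r) ->
    exists2 c, `|c - x| < r & f b - f a = derive1 f c * (b - a).
  move=> ab abr.
  have [||c cab ->] := @MVT R f (derive1 f) a b ab.
  - move=> y yab; have {}yab := itvP yab.
    by apply/is_derive_derive1/df/abr; rewrite yab.
  - apply: continuous_in_subspaceT => y; rewrite inE => /= yab.
    have {}yab := itvP yab.
    by apply: cf; apply: abr; rewrite yab.
  - by exists c => //; apply: abr; rewrite !(itvP cab).
case: (ltgtP z x) zx => // zx _.
- have [|c cr e] := mvt _ _ zx.
    move=> y zy yx; rewrite ler0_norm ?subr_le0 //; apply: le_lt_trans zr.
    by rewrite ltr0_norm ?subr_lt0 // lerN2 lerD2r.
  exists c => //; rewrite -opprB e -(opprB x z) -mulrN mulfK //.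
  by rewrite oppr_eq0 subr_eq0 gt_eqF.
- have [|c cr e] := mvt _ _ zx.
    move=> y xy yz; rewrite ger0_norm ?subr_ge0 //; apply: le_lt_trans zr.
    by rewrite gtr0_norm ?subr_gt0 // lerD2r.
  by exists c => //; rewrite e mulfK // subr_eq0 gt_eqF.
Qed.

(** Hadamard's factorisation F s z - F s x = q (s, z) (z - x), where q is the
    difference quotient of F s, completed on the diagonal z = x.  By the mean
    value theorem q takes values of the second partial derivative at nearby
    points, which makes it continuous at (t, x) in both variables.  Joint
    continuity of F and the chain rule both follow from it. *)
Lemma continuous_slope F t x :
  (\forall p \near (t, x), derivable (F p.1) p.2 1) ->
  {for (t, x), continuous (fun p : R * R => derive1 (F p.1) p.2)} ->
  exists q : R * R -> R,
    [/\ {for (t, x), continuous q}, q (t, x) = derive1 (F t) x &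
        forall s z, F s z = F s x + q (s, z) * (z - x)].
Proof.
move=> dF cF.
pose q (p : R * R) := if p.2 == x then derive1 (F t) x
                      else (F p.1 p.2 - F p.1 x) / (p.2 - x).
have q0 : q (t, x) = derive1 (F t) x by rewrite /q /= eqxx.
exists q; split => [||s z] //; last first.
  rewrite /q /=; case: eqVneq => [->|zx]; first by rewrite subrr mulr0 addr0.
  by rewrite mulfVK ?subr_eq0 // addrC subrK.
apply/cvgrPdist_lt => e e0; rewrite q0.
have /cvgrPdist_lt/(_ e e0) cFe := cF.
have /nbhs_ballP[r /= r0 br] : nbhs (t, x) [set p : R * R |
    derivable (F p.1) p.2 1 /\
    `|derive1 (F t) x - derive1 (F p.1) p.2| < e].
  by near=> p; split; near: p.
have bE (s z : R) : `|s - t| < r -> `|z - x| < r -> ball (t, x) r (s, z).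
  by move=> sr zr; split; rewrite /ball /= distrC.
apply: filterS (nbhsx_ballx (t, x) r r0) => -[s z] [/= sr zr].
rewrite /q /=; case: eqVneq => [_|zx]; first by rewrite subrr normr0.
move: sr zr; rewrite /ball /= distrC => sr; rewrite distrC => zr.
have [|c cr ->] := @mean_value_slope (F s) x z r zx zr.
  by move=> y yr; have [] := br _ (bE s y sr yr).
by have [] := br _ (bE s c sr cr).
Unshelve. all: by end_near.
Qed.

Lemma continuous_of_partial F t x :
  derivable (F^~ x) t 1 ->
  (\forall p \near (t, x), derivable (F p.1) p.2 1) ->
  {for (t, x), continuous (fun p : R * R => derive1 (F p.1) p.2)} ->
  {for (t, x), continuous (fun p : R * R => F p.1 p.2)}.
Proof.
move=> dt dF cF; have [q [cq _ qE]] := continuous_slope _ _ _ dF cF.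
have -> : (fun p : R * R => F p.1 p.2) =
    (fun p => F p.1 x + q p * (p.2 - x)).
  by apply/funext => -[s z] /=; exact: qE.
apply: cvgD; last first.
  by apply: cvgM => //; apply: cvgB; [exact: cvg_snd | exact: cvg_cst].
apply: (@cvg_comp _ _ _ fst (F^~ x) _ (nbhs t)); first exact: cvg_fst.
by move/derivable1_diffP/differentiable_continuous : dt.
Qed.

(** The chain rule along a curve s |-> (s, gamma s), from the continuity of the
    second partial derivative alone: in
    F s (gamma s) - F t (gamma t)
      = (F s (gamma t) - F t (gamma t)) + q (s, gamma s) (gamma s - gamma t)
    with q as in [continuous_slope], the first term is handled by the first
    partial derivative at the point, and q (s, gamma s) tends to the second. *)
Lemma is_derive_along F gamma (t gamma' : R) :
  is_derive t 1 gamma gamma' -> derivable (F^~ (gamma t)) t 1 ->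
  (\forall p \near (t, gamma t), derivable (F p.1) p.2 1) ->
  {for (t, gamma t), continuous (fun p : R * R => derive1 (F p.1) p.2)} ->
  is_derive t 1 (fun s => F s (gamma s))
    (derive1 (F^~ (gamma t)) t + derive1 (F t) (gamma t) * gamma').
Proof.
move=> dg dt dF cF; have [q [cq qt qE]] := continuous_slope _ _ _ dF cF.
have cg : {for t, continuous gamma}.
  have /derivable1_diffP/differentiable_continuous // :=
    @ex_derive _ _ _ _ _ _ _ dg.
have key : h^-1 *: (F (h *: 1 + t) (gamma (h *: 1 + t)) - F t (gamma t))
   @[h --> 0^'] --> derive1 (F^~ (gamma t)) t +
                    derive1 (F t) (gamma t) * gamma'.
  have -> : (fun h : R =>
      h^-1 *: (F (h *: 1 + t) (gamma (h *: 1 + t)) - F t (gamma t)))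
    = (fun h : R => h^-1 *: (F (h *: 1 + t) (gamma t) - F t (gamma t))
         + q (h *: 1 + t, gamma (h *: 1 + t)) *
           (h^-1 *: (gamma (h *: 1 + t) - gamma t))).
    apply/funext => h /=; rewrite qE /GRing.scale /=; ring.
  apply: cvgD.
    by rewrite derive1E; exact: dt.
  apply: cvgM.
    rewrite -qt.
    have ct : (h *: 1 + t : R) @[h --> 0^'] --> t.
      have c0 : h *: (1 : R) + t @[h --> (0 : R)] --> 0 *: (1 : R) + t.
        by apply: cvgD; [exact: scalel_continuous | exact: cvg_cst].
      by rewrite scale0r add0r in c0; exact: cvg_within_filter c0.
    apply: (@cvg_comp _ _ _ (fun h : R => (h *: 1 + t, gamma (h *: 1 + t))) q
       _ (nbhs (t, gamma t))); last exact: cq.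
    have cgt : gamma (h *: 1 + t) @[h --> 0^'] --> gamma t.
      exact: cvg_comp ct cg.
    exact: cvg_pair ct cgt.
  have := @ex_derive _ _ _ _ _ _ _ dg; rewrite /derivable => dg'.
  by have := @derive_val _ _ _ _ _ _ _ dg; rewrite /derive => <-.
apply: DeriveDef; last exact: cvg_lim key.
by apply/cvg_ex; eexists; exact: key.
Qed.

Lemma derive1_translate f a x :
  derive1 (fun z => f (z - a)) x = derive1 f (x - a).
Proof. by rewrite /derive1; under eq_fun do rewrite -addrA. Qed.

Lemma derivable_translate f a x :
  derivable f (x - a) 1 -> derivable (fun z => f (z - a)) x 1.
Proof.
by rewrite /derivable; under [in X in _ -> X]eq_fun do rewrite /= -addrA.
Qed.

Lemma derive1_val {f x df} : is_derive x 1 f df -> derive1 f x = df.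
Proof. by move=> [_ <-]; rewrite derive1E. Qed.

Lemma is_derive_comp_affine f x a k df :
  is_derive (a + k * x) 1 f df ->
  is_derive x 1 (fun z => f (a + k * z)) (df * k).
Proof.
move=> dff; apply: (@is_derive1_comp _ f (fun z => a + k * z)) => //.
have -> : (fun z => a + k * z) = cst a + k \*: id by [].
by apply: is_derive_eq; rewrite add0r /GRing.scale /= mulr1.
Qed.

(** The form in which a symmetry of parity k is differentiated. *)
Lemma derive1_near_scaled f (h : R -> R) x k dh :
  (\forall z \near x, f z = k * h z) -> is_derive x 1 h dh ->
  derive1 f x = k * dh.
Proof.
move=> fh dh'; apply: derive1_val.
have : is_derive x 1 (k \*: h) (k *: dh) by exact: is_deriveZ.
by apply: near_eq_is_derive; apply: filterS fh => z ->.
Qed.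

Lemma cvg_pair_nbhs {S : Type} {F : set_system S} {FF : Filter F}
    {T U : topologicalType} (p : S -> T) (q : S -> U) (a : T) (b : U) :
  p @ F --> a -> q @ F --> b -> ((p s, q s) : T * U) @[s --> F] --> (a, b).
Proof. by move=> pa qb; exact: cvg_pair pa qb. Qed.

Lemma continuous_within_comp {S T U : topologicalType} (A : set T) (B : set S)
    (G : T -> U) (phi : S -> T) :
  {within A, continuous G} -> continuous phi -> (forall s, B s -> A (phi s)) ->
  {within B, continuous (G \o phi)}.
Proof.
move=> /subspace_continuousP cG cphi BA; apply/subspace_continuousP => s Bs.
apply: (@cvg_comp _ _ _ phi G _ (within A (nbhs (phi s)))); last exact/cG/BA.
move=> P /= AP; have := cphi s _ AP.
apply: (@filterS _ (nbhs s)) => z /= + Bz; apply; exact: BA.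
Qed.

Lemma continuous_comp_within {S T U : topologicalType} (A : set T)
    (G : T -> U) (phi : S -> T) :
  {within A, continuous G} -> continuous phi -> (forall s, A (phi s)) ->
  continuous (G \o phi).
Proof.
move=> cG cphi AP; apply/continuous_subspace_setT.
exact: continuous_within_comp cG cphi _.
Qed.

End PartialDerivativeCalculus.

(** * The fluid domain *)

Section FluidDomain.
Local Open Scope classical_set_scope.
Context {R : realType} (d : R) (eta : R -> R -> R).
Hypothesis eta_C1 : C1_surface eta.
Implicit Types (t x y : R) (f : R -> R -> R -> R).

Lemma surface_near {t x} : 0 < t ->
  (\forall p \near (t, x), derivable (eta p.1) p.2 1).
Proof.
move=> t0; have t0n : \forall p \near (t, x), 0 < p.1.
  by apply: (@cvgr_gt _ _ (nbhs (t, x)) _ fst t); [exact: cvg_fst|].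
apply: filterS t0n => -[s z] /= s0.
by have [_ + _ _] := eta_C1 s z s0.
Qed.

Lemma surface_continuous t x : 0 < t ->
  {for (t, x), continuous (fun p : R * R => eta p.1 p.2)}.
Proof.
move=> t0; have [dt _ _ cx] := eta_C1 t x t0.
exact: continuous_of_partial dt (surface_near t0) cx.
Qed.

(** The fluid domain is open because the surface is jointly continuous, so
    relations that hold throughout the fluid may be differentiated. *)
Lemma fluid_nbhs p : fluid d eta p -> \forall q \near p, fluid d eta q.
Proof.
move: p => [[t x] y] [/= t0 dy ye].
have ct : q.1.1 @[q --> (t, x, y)] --> t.
  by apply: (@cvg_comp _ _ _ fst fst _ (nbhs (t, x))); exact: cvg_fst.
have cy : q.2 @[q --> (t, x, y)] --> y by exact: cvg_snd.
have ce : (eta q.1.1 q.1.2 - q.2) @[q --> (t, x, y)] --> eta t x - y.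
  apply: cvgB => //.
  apply: (@cvg_comp _ _ _ fst (fun p : R * R => eta p.1 p.2) _ (nbhs (t, x))).
    exact: cvg_fst.
  exact: surface_continuous.
rewrite -subr_gt0 in ye.
apply: filterS3 (cvgr_gt _ ct _ t0) (cvgr_gt _ cy _ dy) (cvgr_gt _ ce _ ye).
by move=> [[s z] r] /= s0 dr; rewrite subr_gt0.
Qed.

Lemma fluid_nbhs_path (phi : R -> R * R * R) s : phi r @[r --> s] --> phi s ->
  fluid d eta (phi s) -> \forall r \near s, fluid d eta (phi r).
Proof. by move=> cphi /fluid_nbhs; exact: cphi. Qed.

Lemma fluid_nbhs_t t x y : fluid d eta (t, x, y) ->
  \forall s \near t, fluid d eta (s, x, y).
Proof.
apply: (fluid_nbhs_path (fun s => (s, x, y))).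
apply: cvg_pair_nbhs; last exact: cvg_cst.
by apply: cvg_pair_nbhs; [exact: cvg_id | exact: cvg_cst].
Qed.

Lemma fluid_nbhs_x t x y : fluid d eta (t, x, y) ->
  \forall z \near x, fluid d eta (t, z, y).
Proof.
apply: (fluid_nbhs_path (fun z => (t, z, y))).
apply: cvg_pair_nbhs; last exact: cvg_cst.
by apply: cvg_pair_nbhs; [exact: cvg_cst | exact: cvg_id].
Qed.

Lemma fluid_nbhs_y t x y : fluid d eta (t, x, y) ->
  \forall z \near y, fluid d eta (t, x, z).
Proof.
apply: (fluid_nbhs_path (fun z => (t, x, z))).
by apply: cvg_pair_nbhs; [exact: cvg_cst | exact: cvg_id].
Qed.

Lemma fluid_sub t x y : fluid d eta (t, x, y) -> fluid_closed d eta (t, x, y).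
Proof. by move=> [t0 dy ye]; split => //; exact: ltW. Qed.

Lemma fluid_nbhs_tx t x y : fluid d eta (t, x, y) ->
  \forall q \near (t, x), fluid d eta (q.1, q.2, y).
Proof.
move=> /fluid_nbhs.
have cp : ((q.1, q.2, y) : R * R * R) @[q --> (t, x)] --> (t, x, y).
  apply: cvg_pair_nbhs; last exact: cvg_cst.
  by apply: cvg_pair_nbhs; [exact: cvg_fst | exact: cvg_snd].
exact: cp.
Qed.

Lemma continuous_interior f t x y : extends_continuously d eta f ->
  fluid d eta (t, x, y) ->
  {for (t, x), continuous (fun q : R * R => f q.1 q.2 y)}.
Proof.
move=> [G /subspace_continuousP cG fG] txy; have := cG _ (fluid_sub _ _ _ txy).
have cp : ((q.1, q.2, y) : R * R * R) @[q --> (t, x)] --> (t, x, y).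
  apply: cvg_pair_nbhs; last exact: cvg_cst.
  by apply: cvg_pair_nbhs; [exact: cvg_fst | exact: cvg_snd].
move=> cG'; have nf : \forall q \near (t, x), fluid d eta (q.1, q.2, y).
  exact: fluid_nbhs_tx.
have cGq : G (q.1, q.2, y) @[q --> (t, x)] --> G (t, x, y).
  apply: (@cvg_comp _ _ _ (fun q : R * R => (q.1, q.2, y)) G _
    (within (fluid_closed d eta) (nbhs (t, x, y)))); last exact: cG'.
  move=> P /= /cp; rewrite /= !nbhs_simpl /= => h.
  by apply: filterS2 nf h => q qf hq; exact: hq (fluid_sub _ _ _ qf).
rewrite -(fG _ _ _ txy) in cGq; apply: cvg_trans cGq.
apply: near_eq_cvg; apply: filterS nf => q qf.
by rewrite /= fG.
Qed.

End FluidDomain.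

(** * From almost everywhere symmetry to symmetry everywhere *)

Section AlmostEverywhereSymmetry.
Local Open Scope classical_set_scope.
Context {R : realType} (d : R) (eta : R -> R -> R).
Hypotheses (eta_C1 : C1_surface eta)
  (eta_gt : forall t x : R, 0 < t -> - d < eta t x).

Lemma surface_slice_continuous (t : R) : 0 < t -> continuous (eta t).
Proof.
move=> t0 x; have [_ dx _ _] := eta_C1 t x t0.
by move/derivable1_diffP/differentiable_continuous : dx.
Qed.

Lemma continuous_reflection (a : R) : continuous (fun x : R => a - x).
Proof. by move=> x; apply: cvgB; [exact: cvg_cst | exact: cvg_id]. Qed.

Lemma surface_symmetric_everywhere (t a : R) : 0 < t ->
  (\forall x \ae (@lebesgue_measure R), eta t x = eta t (a - x)) ->
  forall x, eta t x = eta t (a - x).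
Proof.
move=> t0 ae x.
apply: (continuous_eq_ae (eta t) (fun x => eta t (a - x))) => //.
  exact: surface_slice_continuous.
move=> z; apply: continuous_comp; first exact: continuous_reflection.
exact: surface_slice_continuous.
Qed.

(** The fluid occupies a range of heights that depends on x, so the height is
    truncated: the curve z |-> (z, min(y, eta t z)) stays in the closed domain
    and passes through (x, y), even when (x, y) lies on the surface.  Along
    it the symmetry is an almost everywhere equality of two continuous
    functions of z. *)
Lemma field_symmetric_everywhere (f : R -> R -> R -> R) (t a k : R) : 0 < t ->
  {within fluid_closed d eta, continuous (fun p => f p.1.1 p.1.2 p.2)} ->
  (forall x, eta t x = eta t (a - x)) ->
  (\forall x \ae (@lebesgue_measure R), forall y : R,
     fluid_closed d eta (t, x, y) -> f t x y = k * f t (a - x) y) ->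
  forall x y : R, fluid_closed d eta (t, x, y) -> f t x y = k * f t (a - x) y.
Proof.
move=> t0 cf eta_sym ae x y [/= _ dy ye].
pose h (z : R) := Num.min y (eta t z).
have ch : continuous h.
  move=> z; apply: (@continuous_min _ _ (cst y) (eta t)); first exact: cvg_cst.
  exact: surface_slice_continuous.
have in1 z : fluid_closed d eta (t, z, h z).
  split=> //=; first by rewrite /h le_min dy ltW // eta_gt.
  by rewrite /h ge_min lexx orbT.
have in2 z : fluid_closed d eta (t, a - z, h z).
  by have [? ? /=] := in1 z; rewrite eta_sym; split.
have c1 : continuous (fun z => f t z (h z)).
  apply: (@continuous_comp_within _ _ _ _ _
    (fun z => (t, z, h z)) cf _ in1) => z.
  apply: cvg_pair_nbhs; last exact: ch.
  by apply: cvg_pair_nbhs; [exact: cvg_cst | exact: cvg_id].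
have c2 : continuous (fun z => f t (a - z) (h z)).
  apply: (@continuous_comp_within _ _ _ _ _
    (fun z => (t, a - z, h z)) cf _ in2) => z.
  apply: cvg_pair_nbhs; last exact: ch.
  by apply: cvg_pair_nbhs; [exact: cvg_cst | exact: continuous_reflection].
have hx : h x = y by apply/min_idPl.
rewrite -[in LHS]hx -[in RHS]hx.
apply: (continuous_eq_ae (fun z => f t z (h z))
  (fun z => k * f t (a - z) (h z))) => //.
  by move=> z; apply: cvgM; [exact: cvg_cst | exact: c2].
by apply: ae_mono ae => z; apply.
Qed.

End AlmostEverywhereSymmetry.

(** * Derivatives of a symmetric field *)

Section Reflection.
Local Open Scope classical_set_scope.
Context {R : realType} (d : R) (eta : R -> R -> R) (lambda : R -> R).
Hypotheses (eta_C1 : C1_surface eta)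
  (eta_sym : forall t x : R, 0 < t -> eta t x = eta t (2 * lambda t - x)).

Lemma fluid_reflection (t x y : R) :
  fluid d eta (t, x, y) -> fluid d eta (t, 2 * lambda t - x, y).
Proof. by case=> /= t0 dy; rewrite eta_sym. Qed.

Lemma is_derive_axis (t x : R) : derivable lambda t 1 ->
  is_derive t 1 (fun s => 2 * lambda s - x) (2 * derive1 lambda t).
Proof.
move=> /is_derive_derive1 dl.
have -> : (fun s => 2 * lambda s - x) = 2 \*: lambda - cst x by [].
by apply: is_derive_eq; rewrite subr0.
Qed.

Lemma surf_x_reflection (t x : R) : 0 < t ->
  surf_x eta t x = - surf_x eta t (2 * lambda t - x).
Proof.
move=> t0; have [_ dx _ _] := eta_C1 t (2 * lambda t - x) t0.
rewrite -mulrN1 -[RHS]mul1r; apply: (derive1_near_scaled _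
  (fun z => eta t (2 * lambda t + -1 * z))).
  by apply: (@filterE _ (nbhs x)) => z; rewrite mul1r mulN1r -eta_sym.
apply: is_derive_comp_affine; rewrite mulN1r.
exact: is_derive_derive1.
Qed.

Lemma surf_t_reflection (t x : R) : 0 < t -> derivable lambda t 1 ->
  surf_t eta t x = surf_t eta t (2 * lambda t - x)
    + surf_x eta t (2 * lambda t - x) * (2 * derive1 lambda t).
Proof.
move=> t0 dl; have [dt _ _ cx] := eta_C1 t (2 * lambda t - x) t0.
rewrite -[RHS]mul1r; apply: (derive1_near_scaled _
  (fun s => eta s (2 * lambda s - x))).
  have : \forall s \near t, 0 < s.
    exact: (@cvgr_gt _ _ (nbhs t) _ id t cvg_id).
  by apply: filterS => s s0; rewrite mul1r -eta_sym.
apply: is_derive_along.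
- exact: is_derive_axis.
- exact: dt.
- exact: surface_near.
- exact: cx.
Qed.

Variables (f : R -> R -> R -> R) (k : R).
Hypothesis f_sym : forall t x y : R, fluid_closed d eta (t, x, y) ->
  f t x y = k * f t (2 * lambda t - x) y.

Lemma dx_reflection (t x y : R) : C1_in_x d eta f -> fluid d eta (t, x, y) ->
  dx f t x y = - k * dx f t (2 * lambda t - x) y.
Proof.
move=> [df _] txy; rewrite mulNr -mulrN -mulrN1.
apply: (derive1_near_scaled _ (fun z => f t (2 * lambda t + -1 * z) y)).
  apply: filterS (fluid_nbhs_x _ _ eta_C1 _ _ _ txy) => z tzy.
  by rewrite mulN1r -f_sym //; exact: fluid_sub.
apply: (is_derive_comp_affine (fun z => f t z y)).
rewrite mulN1r; apply: is_derive_derive1.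
exact/df/fluid_reflection.
Qed.

Lemma dy_reflection (t x y : R) : C1_in_y d eta f -> fluid d eta (t, x, y) ->
  dy f t x y = k * dy f t (2 * lambda t - x) y.
Proof.
move=> [df _] txy.
apply: (derive1_near_scaled _ (fun z => f t (2 * lambda t - x) z)).
  apply: filterS (fluid_nbhs_y _ _ eta_C1 _ _ _ txy) => z tzy.
  by rewrite -f_sym //; exact: fluid_sub.
by apply: is_derive_derive1; exact/df/fluid_reflection.
Qed.

Lemma dt_reflection (t x y : R) : derivable lambda t 1 ->
  C1_in_t d eta f -> C1_in_x d eta f -> fluid d eta (t, x, y) ->
  dt f t x y = k * (dt f t (2 * lambda t - x) y
    + dx f t (2 * lambda t - x) y * (2 * derive1 lambda t)).
Proof.
move=> dl [dft _] [dfx cfx] txy.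
have rtxy := fluid_reflection _ _ _ txy.
apply: (derive1_near_scaled _ (fun s => f s (2 * lambda s - x) y)).
  apply: filterS (fluid_nbhs_t _ _ eta_C1 _ _ _ txy) => s sxy.
  by rewrite -f_sym //; exact: fluid_sub.
apply: (is_derive_along (fun s z => f s z y)).
- exact: is_derive_axis.
- exact: dft.
- apply: filterS (fluid_nbhs_tx _ _ eta_C1 _ _ _ rtxy) => -[s z] /= szy.
  exact: dfx.
- exact: (continuous_interior _ _ eta_C1 _ _ _ _ cfx rtxy).
Qed.

End Reflection.

(** * A symmetric wave drifts with its axis *)

Definition drifts {R : realType} (d : R) (w : wave R) (t c : R) : Prop :=
  (forall x : R, surf_t (surf w) t x = - c * surf_x (surf w) t x) /\
  forall x y : R, fluid d (surf w) (t, x, y) ->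
    dt (velx w) t x y = - c * dx (velx w) t x y /\
    dt (vely w) t x y = - c * dx (vely w) t x y.

(** The equations at a point and at its mirror image, combined with the
    differentiated symmetry, are linear in the time derivatives and determine
    them in terms of the horizontal ones. *)
Lemma symmetric_drifts {R : realType} (g d P0 : R) (w : wave R) :
  classical_solution g d P0 w -> x_symmetric d w ->
  exists c : R -> R, forall t, 0 < t -> drifts d w t (c t).
Proof.
case: w => u v P eta.
move=> [/= wet eta_C1 [[cu u_t [[u_x u_y] _ _]] [cv v_t [[v_x v_y] _ _]]
  [cP _ [[P_x P_y] _ _]]] [/= euler surface _]] [/= lambda lambda_C1 sym_ae].
exists (derive1 lambda) => t t0.
have eta_sym (s x : R) : 0 < s -> eta s x = eta s (2 * lambda s - x).
  move=> s0; apply: surface_symmetric_everywhere eta_C1 _ _ _ _ _ => //.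
  by apply: ae_mono (sym_ae s s0) => z [].
have field_sym (f : R -> R -> R -> R) (k : R) :
    (forall s : R, 0 < s -> (\forall x \ae (@lebesgue_measure R), forall y : R,
      fluid_closed d eta (s, x, y) ->
      f s x y = k * f s (2 * lambda s - x) y)) ->
    {within fluid_closed d eta,
      continuous (fun p => f p.1.1 p.1.2 p.2)}%classic ->
    forall s x y, fluid_closed d eta (s, x, y) ->
      f s x y = k * f s (2 * lambda s - x) y.
  move=> ae cf s x y sxy; have [/= s0 _ _] := sxy.
  exact: (field_symmetric_everywhere d eta eta_C1 wet f s _ k s0 cf
    (fun z => eta_sym s z s0) (ae s s0)).
have u_sym : forall s x y, fluid_closed d eta (s, x, y) ->
    u s x y = 1 * u s (2 * lambda s - x) y.
  apply: field_sym cu => s s0.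
  apply: ae_mono (sym_ae s s0) => z [_ sym] y szy.
  by rewrite mul1r; have [] := sym y szy.
have v_sym : forall s x y, fluid_closed d eta (s, x, y) ->
    v s x y = -1 * v s (2 * lambda s - x) y.
  apply: field_sym cv => s s0.
  apply: ae_mono (sym_ae s s0) => z [_ sym] y szy.
  by rewrite mulN1r; have [] := sym y szy.
have P_sym : forall s x y, fluid_closed d eta (s, x, y) ->
    P s x y = 1 * P s (2 * lambda s - x) y.
  apply: field_sym cP => s s0.
  apply: ae_mono (sym_ae s s0) => z [_ sym] y szy.
  by rewrite mul1r; have [] := sym y szy.
have [dl _] := lambda_C1 t t0.
split => [x|x y txy] /=.
  set x' := 2 * lambda t - x.
  have in1 : fluid_closed d eta (t, x, eta t x).
    by split=> //=; rewrite ltW // wet.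
  have [/= s1 _] := surface t x t0; have [/= s2 _] := surface t x' t0.
  have := surf_x_reflection eta lambda eta_C1 eta_sym t x t0.
  have := surf_t_reflection eta lambda eta_C1 eta_sym t x t0 dl.
  have := u_sym _ _ _ in1; have := v_sym _ _ _ in1.
  rewrite -/x' => ve ue te xe.
  rewrite -(eta_sym t x t0) in s2.
  rewrite ve ue te xe in s1 *.
  lra.
set x' := 2 * lambda t - x.
have tx'y : fluid d eta (t, x', y) by exact: fluid_reflection.
have ein := fluid_sub d eta _ _ _ txy.
have [/= e1 e2 _] := euler t x y txy; have [/= e1' e2' _] := euler t x' y tx'y.
have := u_sym _ _ _ ein; have := v_sym _ _ _ ein.
have := dx_reflection d eta lambda eta_C1 eta_sym u 1 u_sym t x y u_x txy.
have := dx_reflection d eta lambda eta_C1 eta_sym v (-1) v_sym t x y v_x txy.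
have := dx_reflection d eta lambda eta_C1 eta_sym P 1 P_sym t x y P_x txy.
have := dy_reflection d eta lambda eta_C1 eta_sym u 1 u_sym t x y u_y txy.
have := dy_reflection d eta lambda eta_C1 eta_sym v (-1) v_sym t x y v_y txy.
have := dy_reflection d eta lambda eta_C1 eta_sym P 1 P_sym t x y P_y txy.
have := dt_reflection d eta lambda eta_C1 eta_sym u 1 u_sym t x y dl
  u_t u_x txy.
have := dt_reflection d eta lambda eta_C1 eta_sym v (-1) v_sym t x y
  dl v_t v_x txy.
rewrite -/x' => tv tu yP yv yu xP xv xu ve ue.
rewrite tu tv xu xv.
rewrite tv tu yP yv yu xP xv xu ve ue in e1 e2.
split; lra.
Qed.

(** * Launching the state at a given time as a travelling wave *)

Section Launch.
Local Open Scope classical_set_scope.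
Context {R : realType} (d t0 c : R).
Hypothesis t0_gt0 : 0 < t0.
Implicit Types (f : R -> R -> R -> R) (eta : R -> R -> R).

Definition launch_surface eta : R -> R -> R :=
  fun t x => eta t0 (x - c * (t - t0)).

Definition launch_field f : R -> R -> R -> R :=
  fun t x y => f t0 (x - c * (t - t0)) y.

Definition launch (w : wave R) : wave R :=
  Wave (launch_field (velx w)) (launch_field (vely w)) (launch_field (press w))
    (launch_surface (surf w)).

Lemma is_derive_launch (f : R -> R) (t x : R) :
  derivable f (x - c * (t - t0)) 1 ->
  is_derive t 1 (fun s => f (x - c * (s - t0)))
    (- c * derive1 f (x - c * (t - t0))).
Proof.
move=> df.
have e (s : R) : x - c * (s - t0) = x + c * t0 + (- c) * s by ring.
have -> : (fun s => f (x - c * (s - t0))) = (fun s => f (x + c * t0 + - c * s)).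
  by apply/funext => s; rewrite e.
rewrite e in df *; rewrite [- c * derive1 _ _]mulrC.
by apply: is_derive_comp_affine; exact: is_derive_derive1.
Qed.

Lemma dx_launch f : dx (launch_field f) = launch_field (dx f).
Proof.
apply/funext => t; apply/funext => x; apply/funext => y.
exact: (derive1_translate (fun z => f t0 z y)).
Qed.

Lemma surf_x_launch eta :
  surf_x (launch_surface eta) = launch_surface (surf_x eta).
Proof. by apply/funext => t; apply/funext => x; exact: derive1_translate. Qed.

Lemma surf_t_launch eta : C1_surface eta ->
  surf_t (launch_surface eta) =
    (fun t x => - c * launch_surface (surf_x eta) t x).
Proof.
move=> eta_C1; apply/funext => t; apply/funext => x.
apply: derive1_val; apply: is_derive_launch.
have [_ dx _ _] := eta_C1 t0 (x - c * (t - t0)) t0_gt0.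
exact: dx.
Qed.

Lemma continuous_comoving :
  continuous (fun p : R * R => (t0, p.2 - c * (p.1 - t0))).
Proof.
move=> p; apply: cvg_pair_nbhs; first exact: cvg_cst.
apply: cvgB; first exact: cvg_snd.
apply: cvgM; first exact: cvg_cst.
by apply: cvgB; [exact: cvg_fst | exact: cvg_cst].
Qed.

Lemma C1_surface_launch eta : C1_surface eta -> C1_surface (launch_surface eta).
Proof.
move=> eta_C1 t x _; set x' := x - c * (t - t0).
have [_ dx _ cx] := eta_C1 t0 x' t0_gt0.
have cx' : {for (t, x),
    continuous (fun p : R * R => launch_surface (surf_x eta) p.1 p.2)}.
  apply: (@cvg_comp _ _ _ (fun p : R * R => (t0, p.2 - c * (p.1 - t0)))
    (fun p : R * R => surf_x eta p.1 p.2) _ (nbhs (t0, x'))); last exact: cx.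
  exact: (continuous_comoving (t, x)).
split.
- by have [] := is_derive_launch (eta t0) t x dx.
- exact: (derivable_translate (eta t0) _ _ dx).
- rewrite surf_t_launch //.
  by apply: cvgM; [exact: cvg_cst | exact: cx'].
- by rewrite surf_x_launch.
Qed.

Variable eta : R -> R -> R.
Hypothesis eta_C1 : C1_surface eta.

(** The launched wave is the original one composed with this map, which sends
    the closed fluid domain of the former into that of the latter; hence the
    regularity up to the boundary is inherited. *)
Let freeze (p : R * R * R) : R * R * R := (t0, p.1.2 - c * (p.1.1 - t0), p.2).

Lemma continuous_freeze : continuous freeze.
Proof.
move=> p; apply: cvg_pair_nbhs; last exact: cvg_snd.
apply: (@cvg_comp _ _ _ fst (fun q : R * R => (t0, q.2 - c * (q.1 - t0)))
  _ (nbhs p.1)); first exact: cvg_fst.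
exact: continuous_comoving.
Qed.

Lemma fluid_launch (t x y : R) : fluid d (launch_surface eta) (t, x, y) ->
  fluid d eta (t0, x - c * (t - t0), y).
Proof. by case=> /= _ dy ye; split. Qed.

Lemma fluid_closed_launch p :
  fluid_closed d (launch_surface eta) p -> fluid_closed d eta (freeze p).
Proof. by case=> /= _ dy ye; split. Qed.

Lemma extends_launch f : extends_continuously d eta f ->
  extends_continuously d (launch_surface eta) (launch_field f).
Proof.
move=> [G cG fG]; exists (G \o freeze).
  by apply: continuous_within_comp cG continuous_freeze fluid_closed_launch.
by move=> t x y /fluid_launch /fG.
Qed.

Lemma C1_in_x_launch f :
  C1_in_x d eta f -> C1_in_x d (launch_surface eta) (launch_field f).
Proof.
move=> [df ef]; split.
  move=> t x y /fluid_launch /df.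
  exact: (derivable_translate (fun z => f t0 z y)).
by rewrite dx_launch; exact: extends_launch.
Qed.

Lemma C1_in_y_launch f :
  C1_in_y d eta f -> C1_in_y d (launch_surface eta) (launch_field f).
Proof.
move=> [df ef]; split; first by move=> t x y /fluid_launch /df.
exact: (extends_launch (dy f)).
Qed.

Lemma C1_in_space_launch f :
  C1_in_space d eta f -> C1_in_space d (launch_surface eta) (launch_field f).
Proof.
by move=> [fx fy]; split; [exact: C1_in_x_launch | exact: C1_in_y_launch].
Qed.

Lemma is_derive_launch_field f : C1_in_x d eta f -> forall t x y : R,
  fluid d (launch_surface eta) (t, x, y) ->
  is_derive t 1 (fun s => launch_field f s x y)
    (- c * launch_field (dx f) t x y).
Proof.
move=> [df _] t x y /fluid_launch /df.
exact: (is_derive_launch (fun z => f t0 z y)).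
Qed.

Lemma regular_launch f : regular_up_to_boundary d eta f ->
  regular_up_to_boundary d (launch_surface eta) (launch_field f).
Proof.
move=> [cf _ [[fx fy] fxx fyy]]; split.
- exact: (continuous_within_comp _ _ _ freeze cf continuous_freeze
    fluid_closed_launch).
- split; first by move=> t x y /(is_derive_launch_field f fx) [].
  have [G cG fG] := fx.2.
  have [H cH fH] := extends_launch (dx f) fx.2.
  exists (fun p => - c * H p).
    by move=> p; apply: cvgM; [exact: cvg_cst | exact: cH].
  move=> t x y txy; rewrite -fH //.
  exact/derive1_val/is_derive_launch_field.
- split; first exact: C1_in_space_launch.
    by rewrite dx_launch; exact: C1_in_space_launch.
  exact: (C1_in_space_launch (dy f)).
Qed.

End Launch.

(** Since the wave drifts with speed c at time t0, the time derivatives of the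
    launched wave, - c times its horizontal derivatives, are those of the
    original wave at time t0; so each equation for the launched wave is an
    equation for the original one at time t0. *)
Lemma launch_solution {R : realType} (g d P0 t0 c : R) (w : wave R) :
  0 < t0 -> classical_solution g d P0 w -> drifts d w t0 c ->
  classical_solution g d P0 (launch t0 c w).
Proof.
case: w => u v P eta t0_gt0.
move=> [/= wet eta_C1 [ru rv rP] [euler surface bed]] [/= drift_eta drift_uv].
have [_ _ [[ux _] _ _]] := ru; have [_ _ [[vx _] _ _]] := rv.
split=> /=.
- by move=> t x _; exact: wet.
- exact: C1_surface_launch.
- by split; exact: regular_launch.
split.
- move=> t x y txy /=.
  have txy' := fluid_launch d t0 c t0_gt0 eta t x y txy.
  have [/= e1 e2 e3] := euler _ _ _ txy'.
  have [du dv] := drift_uv _ _ txy'.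
  rewrite du in e1; rewrite dv in e2.
  have tu := is_derive_launch_field d t0 c t0_gt0 eta u ux t x y txy.
  have tv := is_derive_launch_field d t0 c t0_gt0 eta v vx t x y txy.
  rewrite !dx_launch /dt (derive1_val tu) (derive1_val tv).
  by split.
- move=> t x _ /=; have [/= s1 s2] := surface t0 (x - c * (t - t0)) t0_gt0.
  rewrite surf_t_launch // surf_x_launch; split; last exact: s2.
  by rewrite drift_eta in s1.
- by move=> t x _; exact: bed.
Qed.

(** * A single speed for all times *)

(** Here c t0 is the speed with which the state at t0 is translated after t0.
    For t < 1 the evolution after 1 is a translation both with speed c t and
    with speed c 1.  If these differ, the state at time 1 is invariant under
    arbitrary translations, and then so is the state at time t. *)
Lemma steady_of_translations {R : realType} {T : Type} (W : R -> R -> T)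
    (c : R -> R) :
  (forall t0 t x, 0 < t0 -> t0 <= t -> W t x = W t0 (x - c t0 * (t - t0))) ->
  forall t x, 0 < t -> W t x = W 1 (x - c 1 * (t - 1)).
Proof.
move=> WE t x t0; have [t1|/ltW t1] := leP 1 t; first exact: WE.
have W1 z : W 1 z = W t (z - c t * (1 - t)) by exact: WE.
have Wt z : W t z = W 1 (z + c t * (1 - t)) by rewrite W1 addrK.
have [e|ne] := eqVneq (c t) (c 1).
  by rewrite Wt e; congr (W 1 _); ring.
have two (s z : R) : 0 <= s -> W 1 (z - c 1 * s) = W 1 (z - c t * s).
  move=> s0; have s1 : 1 <= 1 + s by rewrite lerDl.
  have := WE 1 (1 + s) z ltr01 s1.
  rewrite (WE t (1 + s) z t0 (le_trans t1 s1)) Wt.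
  have -> : z - c t * (1 + s - t) + c t * (1 - t) = z - c t * s by ring.
  by move=> ->; congr (W 1 _); ring.
have cst (a b : R) : W 1 a = W 1 b.
  (* the time that the two speeds take to get a and b apart *)
  pose s := (a - b) / (c t - c 1).
  have cs : c t * s = c 1 * s + a - b.
    have : (c t - c 1) * s = a - b by rewrite mulrC divfK // subr_eq0.
    by rewrite mulrBl => /eqP; rewrite subr_eq => /eqP ->; ring.
  have [s0|/ltW s0] := leP 0 s.
    have := two s (a + c 1 * s) s0; rewrite addrK cs => ->.
    by congr (W 1 _); ring.
  have := two (- s) (b - c 1 * s); rewrite oppr_ge0 => /(_ s0) h.
  have -> : a = b - c 1 * s - c t * - s by rewrite mulrN cs; ring.
  by rewrite -h; congr (W 1 _); ring.
by rewrite Wt; exact: cst.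
Qed.

(** * Symmetric waves are steady *)

(** The values of the fields outside the fluid are masked, so that agreement in
    the fluid becomes an equality and [steady_of_translations] applies. *)
Definition fluid_profile {R : realType} (d : R) (w : wave R) (t x : R) :=
  (surf w t x, fun y => if (- d <= y) && (y <= surf w t x)
     then (velx w t x y, vely w t x y, press w t x y) else (0, 0, 0)).

Lemma profile_coincide {R : realType} (d t : R) (w1 w2 : wave R) : 0 < t ->
  coincide_at d t w1 w2 -> fluid_profile d w1 t = fluid_profile d w2 t.
Proof.
move=> t0 co; apply/funext => x; have [es ef] := co x.
rewrite /fluid_profile -es; congr pair; apply/funext => y.
case: ifP => // /andP[dy ye]; have [] // := ef y.
by move=> -> -> ->.
Qed.

Theorem theorem4p1 (R : realType) (g d P0 : R) (hd : 0 < d)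
  (X : state R -> Prop) (hX : translation_invariant X)
  (huniq : unique_for_initial_data g d P0 X)
  (w : wave R) (hw : solution_in g d P0 X w) (hsym : x_symmetric d w) :
  steady_wave d w.
Proof.
have [w_sol wX] := hw.
have [c w_drifts] := symmetric_drifts _ _ _ _ w_sol hsym.
have launched t0 t x : 0 < t0 -> t0 <= t ->
    fluid_profile d w t x = fluid_profile d w t0 (x - c t0 * (t - t0)).
  move=> t0_gt0 t0t.
  have lw : solution_in g d P0 X (launch t0 (c t0) w).
    split; first exact: launch_solution w_sol (w_drifts t0 t0_gt0).
    by move=> s s0; exact: (hX (c t0 * (s - t0)) _ (wX t0 t0_gt0)).
  have start : coincide_at d t0 w (launch t0 (c t0) w).
    move=> z; have e : z - c t0 * (t0 - t0) = z by rewrite subrr mulr0 subr0.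
    by split=> [|y _]; [|split]; rewrite /= ?/launch_surface ?/launch_field e.
  have co := huniq _ _ hw lw t0 t0_gt0 start t t0t.
  by rewrite (profile_coincide _ _ _ _ (lt_le_trans t0_gt0 t0t) co).
have steady := steady_of_translations _ _ launched.
exists (c 1), (fun z => velx w 1 (z + c 1)), (fun z => vely w 1 (z + c 1)),
  (fun z => press w 1 (z + c 1)), (fun z => surf w 1 (z + c 1)) => t x t_gt0.
have [/= es ef] := steady t x t_gt0.
have -> : x - c 1 * t + c 1 = x - c 1 * (t - 1) by ring.
split => // y [/= _ dy ye].
have := congr1 (fun h => h y) ef; rewrite /= -es dy ye /=.
by case=> -> -> ->.
Qed.
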